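(* Let $K$ be an algebraically closed field (of arbitrary characteristic), let $G$ be a finite group and $H\subset G$ a subgroup. Then $$\beta_{\mathrm{sep}}(H)\le\beta_{\mathrm{sep}}(G)\le [G:H]\,\beta_{\mathrm{sep}}(H),$$ and so $\beta_{\mathrm{sep}}(G)\le |G|$. Moreover, if $H\subset G$ is normal, then $$\beta_{\mathrm{sep}}(G)\le\beta_{\mathrm{sep}}(G/H)\,\beta_{\mathrm{sep}}(H).$$
   Context: For a finite group $G$, a $G$-module is a finite dimensional $K$-vector space $V$ with a linear action of $G$. $\mathcal{O}(V)$ is the ring of polynomial functions on $V$, $\mathcal{O}(V)^{G}$ the subring of $G$-invariant functions, and $\mathcal{O}(V)^G_{\le d}$ the space of $G$-invariant polynomial functions of degree at most $d$. A subset $S\subset\mathcal{O}(V)^{G}$ is called $G$-separating if for all $x,x'\in V$: whenever $f(x)\ne f(x')$ for some $f\in\mathcal{O}(V)^{G}$, there is $h\in S$ with $h(x)\ne h(x')$. Define $$\beta_{\mathrm{sep}}(G,V)=\min\{d\mid \mathcal{O}(V)^{G}_{\le d}\text{ is }G\text{-separating}\}\in\mathbb{N},\qquad \beta_{\mathrm{sep}}(G)=\sup\{\beta_{\mathrm{sep}}(G,V)\mid V \text{ a } G\text{-module}\}\in\mathbb{N}\cup\{\infty\}.$$ *)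

(* Defs.v *)
From HB Require Import structures.
From mathcomp Require Import all_boot all_order all_fingroup all_algebra.
From mathcomp Require Import mxrepresentation.
From mathcomp Require Import boolp classical_sets constructive_ereal ereal.
(* The notations of mpoly clash with those of classical_sets. *)
From mathcomp Require Import -(notations) mpoly.

Set Implicit Arguments.
Unset Strict Implicit.
Unset Printing Implicit Defensive.

Import Order.TTheory GRing.Theory Num.Theory.
Local Open Scope ring_scope.
Local Open Scope classical_set_scope.

Section Separating.

Variables (K : closedFieldType) (gT : finGroupType) (G : {group gT}).

(* A G-module is a matrix representation rG : mx_representation K G n; it is
   the space 'rV[K]_n with g acting on the right by x |-> x *m rG g (on the left
   by the inverse, with the same invariants).  Polynomials in the
   n coordinates represent the polynomial functions on V: K is infinite, so
   each function comes from a unique polynomial. *)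

Definition evalv n (f : mpoly n K) (x : 'rV[K]_n) : K := meval (x 0) f.

Definition invariants n (rG : mx_representation K G n) : set (mpoly n K) :=
  [set f | forall g, g \in G -> forall x, evalv f (x *m rG g) = evalv f x].

(* msize is the total degree plus one, and 0 for the zero polynomial. *)
Definition invariants_le n (rG : mx_representation K G n) (d : nat) :
    set (mpoly n K) :=
  [set f | invariants rG f /\ (msize f <= d.+1)%N].

Definition separating n (rG : mx_representation K G n)
    (S : set (mpoly n K)) : Prop :=
  forall x x' : 'rV[K]_n,
    (exists2 f, invariants rG f & evalv f x <> evalv f x') ->
    exists2 h, S h & evalv h x <> evalv h x'.

Section Existence.

Variables (n : nat) (rG : mx_representation K G n).

Let linpoly (a : 'cV[K]_n) : mpoly n K := \sum_i a i 0 *: mpolyX K (mnm1 i).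

Let evalv_linpoly a x : evalv (linpoly a) x = (x *m a) 0 0.
Proof.
rewrite /evalv /linpoly raddf_sum mxE; apply: eq_bigr => i _ /=.
by rewrite mevalZ mevalXU mulrC.
Qed.

Let affprod c a : mpoly n K :=
  \prod_(g in G) (mpolyC n c - linpoly (rG g *m a)).

Let evalv_affprod c a x :
  evalv (affprod c a) x = \prod_(g in G) (c - (x *m rG g *m a) 0 0).
Proof.
rewrite /evalv /affprod rmorph_prod; apply: eq_bigr => g _ /=.
by rewrite mevalB mevalC -[meval _ (linpoly _)]/(evalv _ _) evalv_linpoly mulmxA.
Qed.

Let msize_aff c a : (msize (mpolyC n c - linpoly a) <= 2)%N.
Proof.
apply: (leq_trans (msizeD_le _ _)); rewrite geq_max msizeN msizeC.
rewrite (leq_trans (leq_b1 _)) //=.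
apply: (leq_trans (msize_sum _ _ _)); apply/bigmax_leqP => i _.
by rewrite (leq_trans (msizeZ_le _ _)) // msizeX mdeg1.
Qed.

Let msize_affprod c a : (msize (affprod c a) <= #|G|.+1)%N.
Proof.
rewrite /affprod cardE -big_enum /=.
elim: (enum _) => [|g s IHs]; first by rewrite big_nil msize1.
rewrite big_cons; set p := _ - _; set q := \prod_(_ <- _) _ in IHs *.
have [->|p0] := eqVneq p 0; first by rewrite mul0r msize0.
have [->|q0] := eqVneq q 0; first by rewrite mulr0 msize0.
rewrite msizeM // -subn1 leq_subLR add1n -(add2n (size s).+1).
exact: leq_add (msize_aff _ _) IHs.
Qed.

Let invariant_affprod c a : invariants rG (affprod c a).
Proof.
move=> g Gg x; rewrite !evalv_affprod [RHS](reindex_inj (mulgI g)) /=.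
apply: eq_big => h; first by rewrite groupMl.
by move=> Gh; rewrite repr_mxM // mulmxA.
Qed.

Let nonvanishing_form (v : gT -> 'rV[K]_n) :
  (forall g, g \in G -> v g != 0) ->
  exists a : 'cV[K]_n, forall g, g \in G -> (v g *m a) 0 0 != 0.
Proof.
move=> nz_v; pose p g : {poly K} := rVpoly (v g).
have: \prod_(g in G) p g != 0.
  apply/prodf_neq0 => g Gg; apply: contraNneq (nz_v g Gg) => p0.
  by rewrite -[v g]rVpolyK -/(p g) p0 linear0.
case/closed_nonrootP => z; rewrite /root horner_prod => /prodf_neq0 nz_pz.
exists (\col_i z ^+ i) => g /nz_pz; apply: contraNneq => va0.
rewrite /p horner_poly -[X in _ == X]va0 mxE; apply/eqP.
by apply: eq_bigr => i _; rewrite mxE valK.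
Qed.

(* A product of affine forms over G, chosen so that it vanishes at x and not
   at x', separates points x and x' of different orbits. *)
Lemma ex_separating_degree :
  exists d, `[< separating rG (invariants_le rG d) >].
Proof.
exists #|G|; apply/asboolP => x x' [f inv_f neq_fx].
have nz_v g : g \in G -> x - x' *m rG g != 0.
  move=> Gg; rewrite subr_eq0; apply/eqP => def_x.
  by apply: neq_fx; rewrite def_x inv_f.
have [a nz_a] := nonvanishing_form nz_v.
pose h := affprod ((x *m a) 0 0) a; exists h.
  exact: conj (invariant_affprod _ _) (msize_affprod _ _).
rewrite !evalv_affprod.
have ->: \prod_(g in G) ((x *m a) 0 0 - (x *m rG g *m a) 0 0) = 0.
  by rewrite (bigD1 1%g) //= repr_mx1 mulmx1 subrr mul0r.
suff /eqP nz : \prod_(g in G) ((x *m a) 0 0 - (x' *m rG g *m a) 0 0) != 0.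
  exact: nesym.
apply/prodf_neq0 => g Gg.
by have := nz_a g Gg; rewrite mulmxBl !mxE.
Qed.

End Existence.

Definition beta_sep_mod n (rG : mx_representation K G n) : nat :=
  ex_minn (ex_separating_degree rG).

Definition beta_sep_values : set (\bar int) :=
  [set b | exists n (rG : mx_representation K G n),
             b = (beta_sep_mod rG)%:Z%:E].

(* The supremum is taken in \bar int; it is a natural number or +oo.  The
   default value -oo of supremum, for sets without a least upper bound, is never
   taken: see beta_sepP. *)
Definition beta_sep : \bar int := supremum -oo%E beta_sep_values.

Lemma beta_sepP : isLub beta_sep_values beta_sep.
Proof.
rewrite /beta_sep; set S := beta_sep_values.
have [b0 Sb0] : exists b, S b.
  have r1 : mx_repr G (fun _ : gT => 1%:M : 'M[K]_0).
    by split=> // g h _ _; rewrite mulmx1.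
  by exists (beta_sep_mod (MxRepresentation r1))%:Z%:E, 0%N, (MxRepresentation r1).
suff [m lub_m] : exists m, isLub S m.
  rewrite /supremum ifF; last by apply/eqP => S0; rewrite S0 in Sb0.
  suff: supremums S m by case: xgetP => [y _ [ub lub] _|/(_ m)//]; split.
  by case: lub_m.
have [[N ubN]|noub] := pselect (exists N : nat, ubound S N%:Z%:E); last first.
  exists +oo%E; split=> [b _|b ub]; first exact: leey.
  case: b ub => [[k|k]||] ub //.
  - by case: noub; exists k.
  - case: noub; exists 0%N => c Sc; apply: (le_trans (ub c Sc)).
    by rewrite lee_fin.
  - by case: noub; exists 0%N => c Sc; apply: (le_trans (ub c Sc)).
have exP : exists k, `[< S k%:Z%:E >].
  by case: Sb0 => n [rG _]; exists (beta_sep_mod rG); apply/asboolP; exists n, rG.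
have ubP k : `[< S k%:Z%:E >] -> (k <= N)%N.
  by move/asboolP/ubN; rewrite lee_fin.
case: (ex_maxnP exP ubP) => m /asboolP Sm max_m; exists m%:Z%:E; split.
  move=> b Sb; case: (Sb) => n [rG def_b]; rewrite def_b lee_fin lez_nat.
  by apply: max_m; apply/asboolP; rewrite -def_b.
by move=> b ub; apply: ub.
Qed.

End Separating.

Arguments beta_sep K {gT} G.

(* Main.v *)
Require Import Defs.
From mathcomp Require Import all_boot all_order all_fingroup all_algebra.
From mathcomp Require Import mxrepresentation.
From mathcomp Require Import boolp constructive_ereal.
From mathcomp Require Import -(notations) mpoly.
Import Order.TTheory GRing.Theory Num.Theory.
Local Open Scope ring_scope.

Set Implicit Arguments.
Unset Strict Implicit.
Unset Printing Implicit Defensive.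

(* Since K is infinite and O(V)^H_{<=d} is a linear space, if for each g in G
   some element of it takes different values at x and x' g, then a single F does
   so for all g simultaneously.  With d = beta_sep(H) this applies whenever x and
   x' lie in different G-orbits.  The product of the functions
   v |-> F(x) - F(v g) over the cosets gH is then G-invariant, vanishes at x and
   not at x'; taking H trivial shows that points in different orbits are
   separated in degree |G|.  If H is normal, v |-> (gH |-> F(v g)) is a
   G-equivariant map of degree d from V to the permutation module of G / H, and
   it suffices to compose it with an invariant of G / H.  Finally, an H-module
   embeds in its induced module, where different H-orbits remain in different
   G-orbits. *)

(** * Polynomial functions of bounded degree *)

Section PolynomialFunctions.

Variable K : fieldType.

(** The polynomial stays existential, so that a function may be replaced by any pointwise equal one;
    [d.+1] appears because [msize] is the degree plus one. *)
Definition polyfun n d (F : 'rV[K]_n -> K) : Prop :=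
  exists2 f : mpoly n K, (msize f <= d.+1)%N
    & forall x : 'rV[K]_n, meval (x 0) f = F x.

Lemma eq_polyfun n d (F F' : 'rV[K]_n -> K) :
  F =1 F' -> polyfun d F -> polyfun d F'.
Proof. by move=> eqF [f le_f def_f]; exists f => // x; rewrite def_f. Qed.

Lemma polyfun_leq n d e (F : 'rV[K]_n -> K) :
  (d <= e)%N -> polyfun d F -> polyfun e F.
Proof. by move=> le_de [f le_f def_f]; exists f => //; apply: leq_trans le_f _. Qed.

Lemma polyfun_const n d c : polyfun d (fun _ : 'rV[K]_n => c).
Proof.
exists (mpolyC n c) => [|x]; last by rewrite mevalC.
by rewrite msizeC (leq_trans (leq_b1 _)).
Qed.

Lemma polyfun_coord n i : polyfun 1 (fun x : 'rV[K]_n => x 0 i).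
Proof.
by exists (mpolyX K (mnm1 i)) => [|x]; rewrite ?msizeX ?mdeg1 ?mevalXU.
Qed.

Lemma polyfunD n d (F F' : 'rV[K]_n -> K) :
  polyfun d F -> polyfun d F' -> polyfun d (fun x => F x + F' x).
Proof.
move=> [f le_f def_f] [f' le_f' def_f']; exists (f + f') => [|x].
  by rewrite (leq_trans (msizeD_le _ _)) // geq_max le_f.
by rewrite mevalD def_f def_f'.
Qed.

Lemma polyfunM n d e (F F' : 'rV[K]_n -> K) :
  polyfun d F -> polyfun e F' -> polyfun (d + e) (fun x => F x * F' x).
Proof.
move=> [f le_f def_f] [f' le_f' def_f']; exists (f * f') => [|x]; last first.
  by rewrite mevalM def_f def_f'.
have [->|f0] := eqVneq f 0; first by rewrite mul0r msize0.
have [->|f'0] := eqVneq f' 0; first by rewrite mulr0 msize0.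
by rewrite msizeM // -subn1 leq_subLR add1n -addSn -addnS leq_add.
Qed.

Lemma polyfunZ n d c (F : 'rV[K]_n -> K) :
  polyfun d F -> polyfun d (fun x => c * F x).
Proof. exact: (polyfunM (@polyfun_const n 0 c)). Qed.

Lemma polyfunB n d (F F' : 'rV[K]_n -> K) :
  polyfun d F -> polyfun d F' -> polyfun d (fun x => F x - F' x).
Proof.
move=> pF /(polyfunZ (-1)); move/(polyfunD pF).
by apply: eq_polyfun => x; rewrite mulN1r.
Qed.

Lemma polyfun_sum n d I (r : seq I) (P : pred I) (F : I -> 'rV[K]_n -> K) :
  (forall i, P i -> polyfun d (F i)) ->
  polyfun d (fun x => \sum_(i <- r | P i) F i x).
Proof.
move=> pF; elim: r => [|i r IHr].
  by apply: eq_polyfun (polyfun_const _ _ 0) => x; rewrite big_nil.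
have [Pi|nPi] := boolP (P i).
  by apply: eq_polyfun (polyfunD (pF i Pi) IHr) => x; rewrite big_cons Pi.
by apply: eq_polyfun IHr => x; rewrite big_cons (negPf nPi).
Qed.

Lemma polyfun_prod n I (r : seq I) (P : pred I) (d : I -> nat)
    (F : I -> 'rV[K]_n -> K) :
  (forall i, P i -> polyfun (d i) (F i)) ->
  polyfun (\sum_(i <- r | P i) d i)%N (fun x => \prod_(i <- r | P i) F i x).
Proof.
move=> pF; elim: r => [|i r IHr].
  by apply: eq_polyfun (polyfun_const _ _ 1) => x; rewrite big_nil.
rewrite big_cons; have [Pi|nPi] := boolP (P i).
  by apply: eq_polyfun (polyfunM (pF i Pi) IHr) => x; rewrite big_cons Pi.
by apply: eq_polyfun IHr => x; rewrite big_cons (negPf nPi).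
Qed.

Lemma polyfunX n d (F : 'rV[K]_n -> K) k :
  polyfun d F -> polyfun (k * d)%N (fun x => F x ^+ k).
Proof.
move=> pF; have := polyfun_prod (index_enum 'I_k) (fun _ (_ : true) => pF).
rewrite sum_nat_const card_ord; apply: eq_polyfun => x.
by rewrite prodr_const card_ord.
Qed.

Lemma polyfun_comp m n d e (F : 'rV[K]_m -> K) (phi : 'rV[K]_n -> 'rV[K]_m) :
  polyfun e F -> (forall i, polyfun d (fun x => phi x 0 i)) ->
  polyfun (e * d)%N (F \o phi).
Proof.
move=> [f le_f def_f] pphi.
(* Expand [F] into monomials. The repeated condition [u \in msupp f] is what bounds the degree of
   [u] by [e] below. *)
suff: polyfun (e * d)%N (fun x =>
    \sum_(u <- msupp f | u \in msupp f)
      mcoeff u f * \prod_(i < m) phi x 0 i ^+ u i).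
  by apply: eq_polyfun => x; rewrite /= -def_f mevalE -big_seq.
apply: polyfun_sum => u f_u; apply: polyfunZ.
apply: polyfun_leq (polyfun_prod _ (fun i _ => polyfunX (u i) (pphi i))).
rewrite -big_distrl /= leq_mul2r -mdegE -ltnS.
by rewrite (leq_trans (msize_mdeg_lt f_u)) ?orbT.
Qed.

End PolynomialFunctions.

(** * Modules of vector-valued functions on a group *)

Section Translation.

Variables (K : fieldType) (gT : finGroupType) (n : nat).

Definition tabulate (F : gT -> 'rV[K]_n) : 'rV[K]_(#|gT| * n) :=
  mxvec (\matrix_(i < #|gT|) F (enum_val i)).

Lemma tabulate_inj F F' : tabulate F = tabulate F' -> F =1 F'.
Proof.
move=> /(can_inj mxvecK)/row_matrixP eqF g.
by have := eqF (enum_rank g); rewrite !rowK enum_rankK.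
Qed.

Lemma eq_tabulate F F' : F =1 F' -> tabulate F = tabulate F'.
Proof.
by move=> eqF; congr mxvec; apply/row_matrixP => i; rewrite !rowK eqF.
Qed.

Lemma tabulate_surj v : exists F, v = tabulate F.
Proof.
exists (fun g => row (enum_rank g) (vec_mx v)); rewrite -[LHS]vec_mxK.
by congr mxvec; apply/row_matrixP => i; rewrite rowK enum_valK.
Qed.

Lemma tabulate_coord k :
  exists g j, forall F, tabulate F 0 k = F g 0 j.
Proof.
have [i j] := mxvec_indexP k.
by exists (enum_val i), j => F; rewrite mxvecE mxE.
Qed.

(** Left multiplication of the argument respects products because matrices act on row vectors from
    the right. *)
Definition translation (a : gT) : 'M[K]_(#|gT| * n) :=
  lin_mx (rowsub (fun i => enum_rank (a * enum_val i)%g)).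

Lemma tabulate_translation F a :
  tabulate F *m translation a = tabulate (fun g => F (a * g)%g).
Proof.
rewrite mul_vec_lin; congr mxvec; apply/row_matrixP => i.
by rewrite row_rowsub !rowK enum_rankK.
Qed.

Lemma translation_repr (G : {group gT}) : mx_repr G translation.
Proof.
(* Both sides are compared on basis vectors, each of which tabulates some function. *)
split=> [|a b _ _]; apply/row_matrixP => i; rewrite rowE [RHS]rowE;
  have [F ->] := tabulate_surj (delta_mx 0 i).
  by rewrite mulmx1 tabulate_translation; apply: eq_tabulate => g; rewrite mul1g.
by rewrite mulmxA !tabulate_translation; apply: eq_tabulate => g; rewrite mulgA.
Qed.

Definition translation_mx_repr G := MxRepresentation (translation_repr G).

End Translation.

(** * Separation by invariants *)

Section Separation.

Variable K : closedFieldType.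

(* The coefficients c i are taken to be the powers of some z: each condition
   then excludes only the roots of a nonzero polynomial. *)
Lemma generic_combination (I J : finType) n d (F : I -> 'rV[K]_n -> K)
    (x : 'rV[K]_n) (y : J -> 'rV[K]_n) :
    (forall i, polyfun d (F i)) ->
    (forall j, exists i, F i x <> F i (y j)) ->
  exists2 c : I -> K, polyfun d (fun v => \sum_i c i * F i v)
    & forall j, \sum_i c i * F i x <> \sum_i c i * F i (y j).
Proof.
(* The inner sum has one term, the [i] of rank [k]. Thus [p j] at [z] is the value at [x] minus that
   at [y j] of the combination with coefficients [z ^+ enum_rank i]. *)
move=> pF neqF; pose p j : {poly K} :=
  \poly_(k < #|I|) \sum_(i | enum_rank i == k :> nat) (F i x - F i (y j)).
have: \prod_j p j != 0.
  apply/prodf_neq0 => j _; have [i /eqP neq_i] := neqF j.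
  apply: contraNneq neq_i => /(congr1 (fun q : {poly K} => q`_(enum_rank i))).
  rewrite coef_poly ltn_ord coef0 (big_pred1 i) => [/eqP|i'].
    by rewrite subr_eq0.
  by rewrite -[LHS]/(enum_rank i' == enum_rank i) (inj_eq enum_rank_inj).
case/closed_nonrootP => z; rewrite /root horner_prod => /prodf_neq0 nz_pz.
exists (fun i => z ^+ enum_rank i).
  by apply: polyfun_sum => i _; apply: polyfunZ.
move=> j /eqP; apply/negP; apply: contra (nz_pz j isT).
rewrite -subr_eq0 -sumrB horner_poly => /eqP eq0; apply/eqP; rewrite -[RHS]eq0.
rewrite (reindex _ (onW_bij _ (@enum_rank_bij I))) /=; apply: eq_bigr => i _.
rewrite (big_pred1 i) => [|i']; first by rewrite -mulrBr mulrC.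
by rewrite -[LHS]/(enum_rank i' == enum_rank i) (inj_eq enum_rank_inj).
Qed.

Definition invfun (gT : finGroupType) (G : {group gT}) n
    (rG : mx_representation K G n) d (F : 'rV[K]_n -> K) : Prop :=
  polyfun d F /\ forall g, g \in G -> forall y, F (y *m rG g) = F y.

Lemma polyfun_mulmx m n d (F : 'rV[K]_m -> K) (A : 'M[K]_(n, m)) :
  polyfun d F -> polyfun d (fun v => F (v *m A)).
Proof.
move=> pF; rewrite -[d]muln1; apply: (polyfun_comp pF) => i.
suff: polyfun 1 (fun v : 'rV_n => \sum_j A j i * v 0 j).
  by apply: eq_polyfun => v; rewrite mxE; apply: eq_bigr => j _; rewrite mulrC.
by apply: polyfun_sum => j _; apply/polyfunZ/polyfun_coord.
Qed.

(** * Products over the cosets of a subgroup *)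

Section Subgroup.

Variables (gT : finGroupType) (G H : {group gT}).
Hypothesis sHG : H \subset G.
Variables (n : nat) (rG : mx_representation K G n).
Let rH := subg_repr rG sHG.

Lemma generic_invfun d (x x' : 'rV[K]_n) :
    (forall g, g \in G -> exists2 F, invfun rH d F & F x <> F (x' *m rG g)) ->
  exists2 F, invfun rH d F & forall g, g \in G -> F x <> F (x' *m rG g).
Proof.
move=> exF.
have {}exF (u : [subg G]) : exists F,
    invfun rH d F /\ F x <> F (x' *m rG (sgval u)).
  by have [F] := exF _ (subgP u); exists F.
have [F FP] := choice exF.
(* The elements of [G] index both the functions and the points to be avoided. *)
have [||c pc neq_c] :=
    @generic_combination _ _ _ d F x (fun u : [subg G] => x' *m rG (sgval u)).
- by move=> u; case: (FP u) => -[].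
- by move=> u; exists u; case: (FP u).
exists (fun v => \sum_u c u * F u v) => [|g Gg].
  split=> // h Hh y; rewrite /=; apply: eq_bigr => u _; congr (_ * _).
  by case: (FP u) => -[_ invF] _; apply: invF.
by have := neq_c (subg G g); rewrite subgK.
Qed.

Lemma invfun_index d (x x' : 'rV[K]_n) :
    (forall g, g \in G -> exists2 F, invfun rH d F & F x <> F (x' *m rG g)) ->
  exists2 F, invfun rG (#|G : H|%g * d) F & F x <> F x'.
Proof.
move=> exF; have [F [pF invF] neqF] := generic_invfun exF.
pose P v := \prod_(A in lcosets H G) (F x - F (v *m rG (repr A))).
have GA A : A \in lcosets H G -> repr A \in G.
  case/lcosetsP => g Gg ->; have /lcosetP[h Hh ->] := mem_repr _ (lcoset_refl H g).
  by rewrite groupM // (subsetP sHG).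
(* In [v *m rG (g * h)] the factor [h] acts last, where the [H]-invariance of [F] absorbs it. *)
have Fcoset v g : g \in G -> F (v *m rG (repr (g *: H)%g)) = F (v *m rG g).
  move=> Gg; have /lcosetP[h Hh ->] := mem_repr _ (lcoset_refl H g).
  by rewrite repr_mxM ?(subsetP sHG h) // mulmxA [LHS]invF.
exists P; [split=> [|a Ga v] |].
- rewrite -card_lcosets -sum_nat_const; apply: polyfun_prod => A AG.
  by apply: polyfunB; [apply: polyfun_const | apply: polyfun_mulmx].
(* Left multiplication by [a] permutes the left cosets, hence the factors. *)
- rewrite /P [RHS](reindex_inj (@lcoset_inj _ a)) /=.
  apply: eq_big => [A|A AG].
    apply/lcosetsP/lcosetsP => [[g Gg ->]|[g Gg def_A]].
      by exists (a * g)%g; rewrite ?groupM // lcosetM.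
    exists (a^-1 * g)%g; first by rewrite groupM ?groupV.
    by rewrite lcosetM -def_A lcosetK.
  case/lcosetsP: AG => g Gg ->; rewrite -lcosetM !Fcoset ?groupM //.
  by rewrite repr_mxM // mulmxA.
have HG : (1 *: H)%g \in lcosets H G by apply/lcosetsP; exists 1%g.
have ->: P x = 0 by rewrite /P (bigD1 _ HG) /= Fcoset // repr_mx1 mulmx1 subrr mul0r.
apply: nesym; apply/eqP/prodf_neq0 => A AG; rewrite subr_eq0; apply/eqP.
exact/neqF/GA.
Qed.

End Subgroup.

(** * Separating degrees and their supremum *)

Section Degree.

Variables (gT : finGroupType) (G : {group gT}).

Lemma invfun_order n (rG : mx_representation K G n) (x x' : 'rV[K]_n) :
    (forall g, g \in G -> x <> x' *m rG g) ->
  exists2 F, invfun rG #|G| F & F x <> F x'.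
Proof.
move=> neq_x; rewrite -[#|G|]muln1 -indexg1.
apply: (@invfun_index _ G [1 gT] (sub1G G)) => g /neq_x neq_g.
have [i neq_i] : exists i, x 0 i <> (x' *m rG g) 0 i.
  by apply/existsNP => eq_x; apply: neq_g; apply/rowP.
exists (fun v => v 0 i) => //; split=> [|h /set1P-> y]; first exact: polyfun_coord.
by rewrite repr_mx1 mulmx1.
Qed.

(** Invariants agree on an orbit, and by [invfun_order] some invariant tells different orbits apart,
    so separating means telling apart all pairs of different orbits. *)
Lemma separatingP n (rG : mx_representation K G n) d :
  separating rG (invariants_le rG d) <->
  forall x x', (forall g, g \in G -> x <> x' *m rG g) ->
    exists2 F, invfun rG d F & F x <> F x'.
Proof.
split=> [sep_d x x' | sepF x x' [f inv_f neq_f]].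
  case/invfun_order => F [[f _ def_f] invF] neqF.
  have [|h [inv_h le_h] neq_h] := sep_d x x'.
    by exists f => [g Gg y|]; rewrite /evalv !def_f ?invF.
  by exists (evalv h) => //; split=> [|g Gg y]; [exists h | apply: inv_h].
have [|F [[h le_h def_h] invF] neqF] := sepF x x'.
  by move=> g Gg def_x; apply: neq_f; rewrite def_x inv_f.
exists h; last by rewrite /evalv !def_h.
by split=> // g Gg y; rewrite /evalv !def_h invF.
Qed.

(** Separating degrees are closed upwards, so the least one is at most [d] exactly when [d] itself
    separates. *)
Lemma beta_sep_leP d :
  (beta_sep K G <= d%:Z%:E)%E <->
  forall n (rG : mx_representation K G n), separating rG (invariants_le rG d).
Proof.
have [ub lub] := beta_sepP K G; split=> [le_d n rG | sep_d].
  have: ((beta_sep_mod rG)%:Z%:E <= d%:Z%:E :> \bar int)%E.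
    by apply: le_trans le_d; apply: ub; exists n, rG.
  rewrite lee_fin lez_nat /beta_sep_mod.
  case: ex_minnP => m /asboolP sep_m _ le_m x x' /sep_m[h [inv_h le_h] neq_h].
  by exists h => //; split=> //; apply: leq_trans le_h _.
apply: lub => _ [n [rG ->]]; rewrite lee_fin lez_nat /beta_sep_mod.
by case: ex_minnP => m _; apply; apply/asboolP.
Qed.

Lemma beta_sep_le_order : (beta_sep K G <= #|G|%:Z%:E)%E.
Proof. by apply/beta_sep_leP => n rG; apply/separatingP/invfun_order. Qed.

(** The group order excludes [+oo]; the zero-dimensional module excludes [-oo] and negative
    values. *)
Lemma beta_sep_nat : exists d : nat, beta_sep K G = d%:Z%:E.
Proof.
have r1 : mx_repr G (fun _ : gT => 1%:M : 'M[K]_0).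
  by split=> // g h _ _; rewrite mulmx1.
have [ub _] := beta_sepP K G; pose rG := MxRepresentation r1.
have: ((beta_sep_mod rG)%:Z%:E <= beta_sep K G)%E by apply: ub; exists 0%N, rG.
by have := beta_sep_le_order; case: (beta_sep K G) => [[d|d]||] //; exists d.
Qed.

End Degree.

(* Instead of the induced module we use all functions from gT to V; x is sent
   to the function that is h |-> x h on H and zero off H. *)
Lemma beta_sep_subgroup (gT : finGroupType) (G H : {group gT}) :
  H \subset G -> (beta_sep K H <= beta_sep K G)%E.
Proof.
move=> sHG; have [d def_d] := beta_sep_nat G; rewrite def_d.
have /beta_sep_leP sepG : (beta_sep K G <= d%:Z%:E)%E by rewrite def_d.
apply/beta_sep_leP => n rH; apply/separatingP => x x' neq_x.
pose ext (v : 'rV[K]_n) g := if g \in H then v *m rH g else 0.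
pose phi v := tabulate (ext v).
have phiM v h : h \in H -> phi (v *m rH h) = phi v *m translation K n h.
  move=> Hh; rewrite tabulate_translation; apply: eq_tabulate => g.
  by rewrite /ext groupMl //; case: ifP => // Hg; rewrite repr_mxM // mulmxA.
have neq_phi a : a \in G -> phi x <> phi x' *m translation K n a.
  move=> Ga; rewrite tabulate_translation => /tabulate_inj eq_phi.
  (* At 1, either [a] is in [H] and [x] lies in the [H]-orbit of [x'], or [x] is zero. In the latter
     case evaluation at [a^-1] gives that [x'] is zero too, so [x = x']. *)
  have := eq_phi 1%g; rewrite /ext group1 mulg1 repr_mx1 mulmx1.
  case: ifP => [Ha /(neq_x a Ha)// | nHa x0].
  have := eq_phi a^-1%g.
  rewrite /ext groupV nHa mulgV group1 repr_mx1 mulmx1 => x'0.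
  by apply: (neq_x 1%g) => //; rewrite repr_mx1 mulmx1 x0.
have /separatingP/(_ _ _ neq_phi)[F [pF invF] neqF] :=
  sepG _ (translation_mx_repr K n G).
exists (F \o phi) => //; split=> [|h Hh y]; last first.
  by rewrite /= phiM // invF // (subsetP sHG).
(* The map [phi] is linear, so composing with it does not raise the degree. *)
rewrite -[d]muln1; apply: polyfun_comp pF _ => k.
have [g [j def_k]] := @tabulate_coord K _ n k.
suff: polyfun 1 (fun v : 'rV[K]_n => ext v g 0 j).
  by apply: eq_polyfun => v; rewrite def_k.
rewrite /ext; case: (g \in H).
  exact: (polyfun_mulmx (rH g) (polyfun_coord K j)).
by apply: eq_polyfun (polyfun_const _ _ 0) => v; rewrite mxE.
Qed.

Lemma beta_sep_index (gT : finGroupType) (G H : {group gT}) :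
  H \subset G -> (beta_sep K G <= #|G : H|%g%:Z%:E * beta_sep K H)%E.
Proof.
move=> sHG; have [d def_d] := beta_sep_nat H; rewrite def_d -EFinM -PoszM.
have /beta_sep_leP sepH : (beta_sep K H <= d%:Z%:E)%E by rewrite def_d.
apply/beta_sep_leP => n rG; apply/separatingP => x x' neq_x.
apply: (invfun_index (sHG := sHG)) => g Gg.
have /separatingP sep := sepH _ (subg_repr rG sHG); apply: sep => h Hh.
rewrite -mulmxA -repr_mxM ?(subsetP sHG h) //.
by apply: neq_x; rewrite groupM // (subsetP sHG).
Qed.

Lemma beta_sep_quotient (gT : finGroupType) (G H : {group gT}) :
  (H <| G)%g -> (beta_sep K G <= beta_sep K (G / H)%G * beta_sep K H)%E.
Proof.
move=> nsHG; have [sHG nHG] := andP nsHG.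
have [d def_d] := beta_sep_nat H; have [e def_e] := beta_sep_nat (G / H)%G.
have /beta_sep_leP sepH : (beta_sep K H <= d%:Z%:E)%E by rewrite def_d.
have /beta_sep_leP sepQ : (beta_sep K (G / H)%G <= e%:Z%:E)%E by rewrite def_e.
rewrite def_d def_e -EFinM -PoszM.
apply/beta_sep_leP => n rG; apply/separatingP => x x' neq_x.
have [g Gg|F [pF invF] neqF] := @generic_invfun _ G H sHG _ rG d x x'.
  have /separatingP sep := sepH _ (subg_repr rG sHG); apply: sep => h Hh.
  rewrite -mulmxA -repr_mxM ?(subsetP sHG h) //.
  by apply: neq_x; rewrite groupM // (subsetP sHG).
have GH_repr (q : coset_of H) : (repr q \in G) = (q \in (G / H)%g).
  apply/idP/idP => [Gq|/morphimP[a Na Ga ->]].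
    by rewrite -[q]coset_reprK mem_quotient.
  have := mem_repr_coset (coset H a); rewrite val_coset // => /rcosetP[h Hh ->].
  by rewrite groupM // (subsetP sHG).
have Fcoset v a b : a \in G -> b \in G -> coset H a = coset H b ->
    F (v *m rG a) = F (v *m rG b).
  (* Normality turns [h * b] into [b * h ^ b], with the element of [H] now acting last. *)
  move=> Ga Gb /(kercoset_rcoset (subsetP nHG _ Ga) (subsetP nHG _ Gb))[h Hh ->].
  have Hhb : (h ^ b)%g \in H by rewrite memJ_norm // (subsetP nHG).
  rewrite conjgC repr_mxM ?(subsetP sHG _ Hhb) // mulmxA.
  exact: (invF _ Hhb).
(* The type [coset_of H] covers the whole normalizer of [H], hence the value 0 outside [G / H]. *)
pose val v (q : coset_of H) : 'rV[K]_1 :=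
  if q \in (G / H)%g then (F (v *m rG (repr q)))%:M else 0.
pose phi v := tabulate (val v).
have phiM v a : a \in G -> phi (v *m rG a) = phi v *m translation K 1 (coset H a).
  move=> Ga; rewrite tabulate_translation; apply: eq_tabulate => q.
  have GHa : coset H a \in (G / H)%g by apply: mem_quotient.
  rewrite /val groupMl //; case: ifP => // GHq; congr (_%:M).
  rewrite -mulmxA -repr_mxM ?GH_repr //.
  apply: Fcoset; rewrite ?GH_repr ?groupM ?GH_repr // coset_reprK.
  rewrite (coset_morphM (subsetP nHG _ Ga) (repr_coset_norm q)).
  by rewrite coset_reprK.
(* By equivariance the right side is [phi] at [x'] moved by [repr q]; evaluation at 1 then
   contradicts the choice of [F]. *)
have neq_phi q : q \in (G / H)%g -> phi x <> phi x' *m translation K 1 q.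
  move=> GHq; rewrite -{1}[q]coset_reprK -phiM ?GH_repr //.
  move=> /tabulate_inj eq_phi.
  have := congr1 (fun M : 'rV[K]_1 => M 0 0) (eq_phi 1%g).
  rewrite /val group1 repr_coset1 !repr_mx1 !mulmx1 !mxE !mulr1n.
  by apply: neqF; rewrite GH_repr.
have /separatingP/(_ _ _ neq_phi)[P [pP invP] neqP] :=
  sepQ _ (translation_mx_repr K 1 (G / H)).
exists (P \o phi) => //; split=> [|a Ga y]; last first.
  by rewrite /= phiM // invP // mem_quotient.
apply: polyfun_comp pP _ => k.
have [q [j def_k]] := @tabulate_coord K _ 1 k.
suff: polyfun d (fun v : 'rV[K]_n => val v q 0 j).
  by apply: eq_polyfun => v; rewrite def_k.
rewrite /val; case: (q \in (G / H)%g).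
  apply: eq_polyfun (polyfun_mulmx (rG (repr q)) pF) => v.
  by rewrite mxE !ord1 mulr1n.
by apply: eq_polyfun (polyfun_const _ _ 0) => v; rewrite mxE.
Qed.

End Separation.

Theorem theoremB (K : closedFieldType) (gT : finGroupType) (G H : {group gT})
    (sHG : H \subset G) :
  [/\ (beta_sep K H <= beta_sep K G)%E,
      (beta_sep K G <= #|G : H|%g%:Z%:E * beta_sep K H)%E,
      (beta_sep K G <= #|G|%:Z%:E)%E
    & (H <| G)%g -> (beta_sep K G <= beta_sep K (G / H)%G * beta_sep K H)%E].
Proof.
split; [exact: beta_sep_subgroup | exact: beta_sep_index
  | exact: beta_sep_le_order | exact: beta_sep_quotient].
Qed.
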